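(* Let $X$ be a Banach space. If there exists a uniform embedding of $X$ into $T^*$ (resp. $S$), then there exists a strong embedding of $X$ into $T^*$ (resp. $S$).
   Context: For a map $f:(M,d)\to(N,\partial)$ between metric spaces and $t\ge 0$, let $\omega_f(t)=\sup\{\partial(f(x),f(y)) : d(x,y)\le t\}$ and $\rho_f(t)=\inf\{\partial(f(x),f(y)) : d(x,y)\ge t\}$ (with $\inf\emptyset=\infty$). $f$ is coarse if $\omega_f(t)<\infty$ for all $t\ge 0$; expanding if $\lim_{t\to\infty}\rho_f(t)=\infty$; a coarse embedding if it is both coarse and expanding; a uniform embedding if $\lim_{t\to 0^+}\omega_f(t)=0$ and $\rho_f(t)>0$ for all $t>0$; a strong embedding if it is simultaneously a coarse embedding and a uniform embedding. For finite subsets $E,F\subset\mathbb{N}$ write $E<F$ if $\max E<\min F$, and for $x\in c_{00}$ let $Ex$ be the restriction of $x$ to $E$ (zero off $E$). $T$ denotes the Tsirelson space introduced by Figiel and Johnson: the completion of $c_{00}$ under the unique norm satisfying $\|x\|=\max\{\|x\|_\infty,\ \tfrac12\sup\sum_{j=1}^k\|E_jx\|\}$, the supremum over all $k\in\mathbb{N}$ and finite nonempty sets $E_1<\dots<E_k$ with $k\le\min E_1$; $T^*$ is its dual. $S$ denotes the Schlumprecht space: the completion of $c_{00}$ under the unique norm satisfying $\|x\|=\max\{\|x\|_\infty,\ \sup_{k\ge2}\frac{1}{\log_2(k+1)}\sup\sum_{j=1}^k\|E_jx\|\}$, the inner supremum over all finite nonempty sets $E_1<\dots<E_k$. *)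

(* Defs.v *)
From HB Require Import structures.
From mathcomp Require Import all_boot all_order all_algebra finmap.
From mathcomp Require Import all_classical all_reals all_analysis.

Set Implicit Arguments.
Unset Strict Implicit.
Unset Printing Implicit Defensive.

Import Order.TTheory GRing.Theory Num.Theory.
Import numFieldNormedType.Exports.

Local Open Scope classical_set_scope.
Local Open Scope ring_scope.

(* Maps between normed spaces, regarded as metric spaces for `|x - y|. The
   moduli are extended reals; ereal_inf set0 = +oo. *)
Section Embeddings.
Context {R : realType} {M N : normedModType R}.
Implicit Types (f : M -> N) (t : R).

Definition modulus f t : \bar R :=
  ereal_sup [set `|f p.1 - f p.2|%:E | p in [set p : M * M | `|p.1 - p.2| <= t]].

Definition comodulus f t : \bar R :=
  ereal_inf [set `|f p.1 - f p.2|%:E | p in [set p : M * M | t <= `|p.1 - p.2|]].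

Definition coarse f := forall t, 0 <= t -> (modulus f t < +oo)%E.

Definition expanding f := comodulus f t @[t --> +oo] --> +oo%E.

Definition coarse_embedding f := coarse f /\ expanding f.

Definition uniform_embedding f :=
  modulus f t @[t --> 0^'+] --> 0%E /\
  (forall t, 0 < t -> (0 < comodulus f t)%E).

Definition strong_embedding f := coarse_embedding f /\ uniform_embedding f.

End Embeddings.

(* The topological dual of V, with the operator norm. *)
Section Dual.
Context {R : realType} (V : normedModType R).

Definition is_dual : {pred V -> R^o} :=
  fun f => `[< linear f /\ continuous f >].

Record dual := Dual { dual_fun :> V -> R^o; _ : dual_fun \in is_dual }.

HB.instance Definition _ := [isSub for dual_fun].
HB.instance Definition _ := [Choice of dual by <:].

Fact is_dual_submod_closed : submod_closed is_dual.
Proof.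
split=> [|a f g /asboolP[lf cf] /asboolP[lg cg]]; apply/asboolP; split.
- by move=> a x y; rewrite scaler0 addr0.
- by move=> x; exact: cvg_cst.
- move=> b x y.
  have E u : (a *: f + g) u = a *: f u + g u by [].
  rewrite !E lf lg !scalerDr !scalerA [b * a]mulrC.
  by rewrite addrACA.
- move=> x; apply: cvgD; last exact: cg.
  by apply: cvgZl_tmp; exact: cf.
Qed.

HB.instance Definition _ := GRing.isSubmodClosed.Build R (V -> R^o) is_dual
  is_dual_submod_closed.
HB.instance Definition _ := [SubChoice_isSubLmodule of dual by <:].

Definition dual_norm (f : dual) : R :=
  sup [set `|f x| | x in [set x | `|x| <= 1]].

Lemma dual_linear (f : dual) : linear f.
Proof. by case: f => f /= /asboolP[]. Qed.

Lemma dual_continuous (f : dual) : continuous f.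
Proof. by case: f => f /= /asboolP[]. Qed.

HB.instance Definition _ (f : dual) :=
  GRing.isLinear.Build R V R^o _ f (dual_linear f).

Fact dual_norm_has_sup (f : dual) :
  has_sup [set `|f x| | x in [set x | `|x| <= 1]].
Proof.
split; first by exists `|f 0|; exists 0 => //=; rewrite normr0.
have /linear_bounded_continuous/bounded_funP/(_ 1)[M HM] :=
  @dual_continuous f.
by exists M => _ [x /= x1 <-]; exact: HM.
Qed.

Lemma dual_norm_ub (f : dual) x : `|x| <= 1 -> `|f x| <= dual_norm f.
Proof.
by move=> x1; apply: (sup_upper_bound (dual_norm_has_sup f)); exists x.
Qed.

Lemma dual_norm_le (f : dual) (c : R) :
  (forall x, `|x| <= 1 -> `|f x| <= c) -> dual_norm f <= c.
Proof.
move=> fc; apply: ge_sup; first by case: (dual_norm_has_sup f).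
by move=> _ [x /= x1 <-]; exact: fc.
Qed.

Fact dual_normD (f g : dual) : dual_norm (f + g) <= dual_norm f + dual_norm g.
Proof.
apply: dual_norm_le => x x1; rewrite (le_trans (ler_normD _ _))//.
by apply: lerD; exact: dual_norm_ub.
Qed.

Fact dual_normZ (a : R) (f : dual) : dual_norm (a *: f) = `|a| * dual_norm f.
Proof.
have le b h : dual_norm (b *: h) <= `|b| * dual_norm h.
  apply: dual_norm_le => x x1.
  have -> : (b *: h) x = b * h x by [].
  by rewrite normrM ler_wpM2l// dual_norm_ub.
apply/eqP; rewrite eq_le le/=; have [->|a0] := eqVneq a 0.
  by rewrite normr0 mul0r (le_trans (normr_ge0 _) (@dual_norm_ub _ 0 _))// normr0.
rewrite mulrC -ler_pdivlMr ?normr_gt0// mulrC -normfV.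
by have := le a^-1 (a *: f); rewrite scalerA mulVf// scale1r.
Qed.

Fact dual_norm0_eq0 (f : dual) : dual_norm f = 0 -> f = 0.
Proof.
move=> f0; apply/val_inj/funext => x /=; have [->|x0] := eqVneq x 0.
  by rewrite linear0.
have := @dual_norm_ub f (`|x|^-1 *: x).
rewrite f0 normrZ normfV normr_id mulVf ?normr_eq0// => /(_ (lexx _)).
rewrite normr_le0 linearZ/= mulf_eq0 invr_eq0 normr_eq0 (negbTE x0)/=.
by move/eqP.
Qed.

HB.instance Definition _ := Lmodule_isNormed.Build R dual
  dual_normD dual_normZ dual_norm0_eq0.

End Dual.

(* Finitely supported real sequences. *)
Section C00.
Context {R : realType}.

Definition fin_supp : {pred nat -> R^o} :=
  fun x => `[< exists n, forall i, (n <= i)%N -> x i = 0 >].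

Record c00 := C00 { c00_fun :> nat -> R^o; _ : c00_fun \in fin_supp }.

HB.instance Definition _ := [isSub for c00_fun].
HB.instance Definition _ := [Choice of c00 by <:].

Fact fin_supp_submod_closed : submod_closed fin_supp.
Proof.
split=> [|a x y /asboolP[n xn] /asboolP[m ym]]; apply/asboolP.
  by exists 0%N.
exists (maxn n m) => i; rewrite geq_max => /andP[ni mi].
by rewrite -[LHS]/(a *: x i + y i) xn// ym// scaler0 addr0.
Qed.

HB.instance Definition _ := GRing.isSubmodClosed.Build R (nat -> R^o) fin_supp
  fin_supp_submod_closed.
HB.instance Definition _ := [SubChoice_isSubLmodule of c00 by <:].

Fact restr_fin_supp (E : {fset nat}) (x : c00) :
  (fun i => if i \in E then x i else 0) \in fin_supp.
Proof.
case: x => x /= /asboolP[n xn]; apply/asboolP; exists n => i ni.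
by case: ifP => // _; exact: xn.
Qed.

Definition restr (E : {fset nat}) (x : c00) : c00 := C00 (restr_fin_supp E x).

End C00.
Arguments c00 R : clear implicits.

Definition fset_lt (E F : {fset nat}) : bool :=
  [forall i : E, forall j : F, (val i < val j)%N].

Definition blocks (Es : seq {fset nat}) : bool :=
  all (fun E => E != fset0) Es && pairwise fset_lt Es.

(* Indices i : nat stand for the coordinates i.+1 = 1, 2, 3, ... of the usual
   indexing, so that k <= min E_1 reads k <= i.+1 for all i in E_1. *)
Definition admissible (Es : seq {fset nat}) : Prop :=
  [/\ blocks Es, (0 < size Es)%N &
      forall i, i \in head fset0 Es -> (size Es <= i.+1)%N].

Section ImplicitNorms.
Context {R : realType}.
Implicit Types (N : c00 R -> R) (x : c00 R).

Definition is_norm N :=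
  [/\ forall x y, N (x + y) <= N x + N y,
      forall (a : R) x, N (a *: x) = `|a| * N x &
      forall x, N x = 0 -> x = 0].

Definition supnorm x : \bar R := ereal_sup (range (fun i => `|x i|%:E)).

Definition block_sum N x (Es : seq {fset nat}) : R :=
  \sum_(E <- Es) N (restr E x).

Definition tsirelson_norm N :=
  is_norm N /\
  forall x, (N x)%:E =
    maxe (supnorm x)
      ((2^-1)%:E * ereal_sup [set (block_sum N x Es)%:E | Es in admissible])%E.

Definition log2 (a : R) : R := ln a / ln 2.

Definition schlumprecht_norm N :=
  is_norm N /\
  forall x, (N x)%:E =
    maxe (supnorm x)
      (ereal_sup [set ((log2 k.+1%:R)^-1)%:E *
         ereal_sup [set (block_sum N x Es)%:E
                   | Es in [set Es | blocks Es /\ size Es = k]]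
       | k in [set k | (2 <= k)%N]])%E.

(* T is (isometrically) the completion of c00 under N. *)
Definition is_completion N (T : completeNormedModType R) :=
  exists iota : {linear c00 R -> T},
    (forall x, `|iota x| = N x) /\ dense (range iota).

Definition is_tsirelson_space (T : completeNormedModType R) :=
  exists N, tsirelson_norm N /\ is_completion N T.

Definition is_schlumprecht_space (S : completeNormedModType R) :=
  exists N, schlumprecht_norm N /\ is_completion N S.

End ImplicitNorms.

(* Main.v *)
Require Import Defs.
From HB Require Import structures.
From mathcomp Require Import all_boot all_order all_algebra finmap.
From mathcomp Require Import all_classical all_reals all_analysis.
From mathcomp Require Import zify lra.

Set Implicit Arguments.
Unset Strict Implicit.
Unset Printing Implicit Defensive.

Import Order.TTheory GRing.Theory Num.Theory.
Import numFieldNormedType.Exports.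

Local Open Scope classical_set_scope.
Local Open Scope ring_scope.

(** A uniform embedding [f] is rescaled infinitely often and the copies are
    glued together. If [Y] contains countably many independent complemented
    copies of itself, that is, bounded linear maps [A n] and [B n] with
    [B n \o A m = delta_nm id], put
      [g x = \sum_n A n (w n *: (f (s n *: x) - f 0))].
    A uniformly continuous map on a normed space is Lipschitz for large
    distances, so once the weights [w n] are fixed, taking [s n] small enough
    makes the [n]-th term of [g x - g y] at most [k 2^-n] as soon as
    [|x - y| <= k]: this gives convergence, coarseness and uniform continuity.
    Applying [B n] isolates the [n]-th term, and
    [w n = n.+1 * C n], where [C n] bounds the norms of [A n] and [B n], yields
    [|g x - g y| >= n.+1 * |f (s n *: x) - f (s n *: y)|]. The factor [n.+1]
    makes [g] expanding, whatever the geometry of the sum of the copies and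
    however fast [C n] grows; the case [n = 0] bounds the comodulus of [g]
    below. This is [strong_of_uniform].

    Two independent copies give countably many ([countable_copies]), and the
    property passes to the dual by transposition ([dual_absorbs_square]). So it
    remains to find two independent copies inside the Tsirelson and Schlumprecht
    spaces. On finitely supported sequences they are the sequences living on the
    even, resp. odd, indices: [stretch b] moves the coordinate [i] to [2i + b],
    and [shrink b] reads it back. Both norms solve an implicit equation
    involving families of blocks, and inequalities between such norms are proved
    by induction on the support ([inorm_least_proper]).
    Moving a block to the right keeps it admissible, so [shrink b] is a
    contraction for both norms ([le_inorm_shrink]). For the Schlumprecht norm
    [stretch b] is a contraction too. For the Tsirelson norm, pulling back an
    admissible family through [stretch b] loses a factor two in the
    admissibility condition; a doubling argument shows that only three
    successive pieces are needed to repair it, at every depth of the induction,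
    whence [N (stretch b x) <= 3 * N x] ([tsirelson_stretch_le]).
    These maps extend to the completions by density ([bounded_extension]). *)

(** * Metric form of the embedding conditions *)

Section Moduli.
Context {R : realType} {M N : normedModType R}.
Implicit Types f g : M -> N.

Lemma modulus_le f t (c : R) :
  (modulus f t <= c%:E)%E <->
  forall x y, `|x - y| <= t -> `|f x - f y| <= c.
Proof.
split=> [fc x y xy|fc]; last first.
  by apply: ge_ereal_sup => _ [[x y] /= xy <-]; rewrite lee_fin; exact: fc.
rewrite -lee_fin; apply: le_trans fc; apply: ereal_sup_ubound.
by exists (x, y).
Qed.

Lemma comodulus_ge f t (c : R) :
  (c%:E <= comodulus f t)%E <->
  forall x y, t <= `|x - y| -> c <= `|f x - f y|.
Proof.
split=> [fc x y xy|fc]; last first.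
  by apply: le_ereal_inf_tmp => _ [[x y] /= xy <-]; rewrite lee_fin; exact: fc.
rewrite -lee_fin; apply: (le_trans fc); apply: ereal_inf_lbound.
by exists (x, y).
Qed.

Lemma modulus_ge0 f t : 0 <= t -> (0 <= modulus f t)%E.
Proof.
move=> t0; apply: ereal_sup_ubound; exists (0, 0) => /=.
  by rewrite subr0 normr0.
by rewrite subrr normr0.
Qed.

Lemma comodulus_gt0P f t : (0 < comodulus f t)%E <->
  exists2 c : R, 0 < c & forall x y, t <= `|x - y| -> c <= `|f x - f y|.
Proof.
split=> [|[c c0 /comodulus_ge]]; last by apply: lt_le_trans; rewrite lte_fin.
case E : (comodulus f t) => [r| |] //.
  rewrite lte_fin => r0; exists r => //; apply/comodulus_ge.
  by rewrite E.
by move=> _; exists 1 => //; apply/comodulus_ge; rewrite E leey.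
Qed.

Lemma coarseP f : coarse f <->
  forall t, 0 <= t -> exists c, forall x y, `|x - y| <= t -> `|f x - f y| <= c.
Proof.
split=> [cf t t0|cf t t0].
  have := cf _ t0; have := modulus_ge0 f t0.
  case E : (modulus f t) => [r| |] // _ _; exists r; apply/modulus_le.
  by rewrite E.
have [c /modulus_le fc] := cf _ t0.
by rewrite (le_lt_trans fc)// ltry.
Qed.

Lemma expandingP f : expanding f <->
  forall c : R, exists t0, forall x y, t0 <= `|x - y| -> c <= `|f x - f y|.
Proof.
rewrite /expanding cvgeyPge; split=> ef c; have := ef c.
  move=> [t [_ tc]]; exists (t + 1) => x y xy.
  have tt1 : t < t + 1 by rewrite ltrDl.
  have /comodulus_ge := tc _ tt1.
  exact.
move=> [t tc]; near=> s; apply/comodulus_ge => x y sxy; apply: tc.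
apply: le_trans sxy; near: s; apply: nbhs_pinfty_ge; exact: num_real.
Unshelve. all: by end_near.
Qed.

Lemma uniform_embeddingP f : uniform_embedding f <->
  (forall e : R, 0 < e -> exists2 d, 0 < d &
     forall x y, `|x - y| <= d -> `|f x - f y| <= e) /\
  (forall t : R, 0 < t -> exists2 c, 0 < c &
     forall x y, t <= `|x - y| -> c <= `|f x - f y|).
Proof.
have co : (forall t : R, 0 < t -> (0 < comodulus f t)%E) <->
  (forall t : R, 0 < t -> exists2 c, 0 < c &
     forall x y, t <= `|x - y| -> c <= `|f x - f y|).
  by split=> h t t0; apply/comodulus_gt0P; exact: h.
rewrite /uniform_embedding co; split=> -[uf cf]; split=> //.
  move=> e e0.
  have /fine_cvgP[fnum /cvgrPdist_le/(_ e e0)h] := uf.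
  have : \forall t \near 0^'+, (0 < t) /\ (modulus f t <= e%:E)%E.
    near=> t; split; first by near: t; exact: nbhs_right_gt.
    have ft : modulus f t \is a fin_num by near: t.
    have : `|0 - fine (modulus f t)| <= e by near: t; exact: h.
    rewrite sub0r normrN => /(le_trans (ler_norm _)).
    by rewrite -lee_fin fineK.
  move=> /filter_ex[t [t0 /modulus_le ft]]; by exists t.
apply/fine_cvgP.
have h e : 0 < e -> \forall t \near 0^'+,
    [/\ 0 < t, (0 <= modulus f t)%E & (modulus f t <= e%:E)%E].
  move=> e0; have [d d0 de] := uf _ e0.
  near=> t.
  have t0 : 0 < t by near: t; exact: nbhs_right_gt.
  split=> //; first exact: (modulus_ge0 f (ltW t0)).
  apply/modulus_le => x y xy; apply: de; apply: (le_trans xy).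
  by near: t; exact: nbhs_right_le.
split.
  apply: filterS (h 1 ltr01) => t [_ m0 m1].
  by rewrite fin_numElt (lt_le_trans _ m0) ?ltNyr// (le_lt_trans m1)// ltry.
apply/cvgrPdist_le => e e0; apply: filterS (h e e0) => t [_ m0 me] /=.
rewrite sub0r normrN ger0_norm ?fine_ge0//.
rewrite -lee_fin fineK//.
by rewrite fin_numElt (lt_le_trans _ m0) ?ltNyr// (le_lt_trans me)// ltry.
Unshelve. all: by end_near.
Qed.

End Moduli.

(** * Countably many independent copies of a space in itself *)

Section Copies.
Context {R : realType}.
Implicit Types Y : normedModType R.

(** [Y] contains a complemented isomorphic copy of its square: [A] gives the
    embeddings of the two factors, [B] the coordinate projections. *)
Definition absorbs_square Y := exists (A B : bool -> {linear Y -> Y}) (C : R),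
  [/\ 1 <= C,
      forall b y, `|A b y| <= C * `|y| /\ `|B b y| <= C * `|y| &
      forall b c y, B b (A c y) = if b == c then y else 0].

(** Keep one of the two copies and split the other one again, forever:
    [A n = A_true^n \o A_false] and [B n = B_false \o B_true^n]. For [n <> m]
    the composite [B n \o A m] meets either [B_false \o A_true] or
    [B_true \o A_false], both of which vanish. *)
Lemma countable_copies Y : absorbs_square Y ->
  exists (A B : nat -> {linear Y -> Y}) (C : nat -> R),
  [/\ forall n, 0 < C n,
      forall n y, `|A n y| <= C n * `|y| /\ `|B n y| <= C n * `|y| &
      forall n m y, B n (A m y) = if n == m then y else 0].
Proof.
move=> [A [B [C [C1 bd BA]]]].
pose a n y := iter n (A true) (A false y).
pose b n y := B false (iter n (B true) y).
have linA n : linear (a n).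
  elim: n => [|n IH] k x y; first exact: linearP.
  by rewrite /a !iterS -!/(a n _) IH linearP.
have linBt n : linear (iter n (B true)).
  by elim: n => [|n IH] k x y//=; rewrite IH linearP.
have linB n : linear (b n) by move=> k x y; rewrite /b linBt linearP.
pose A' n : {linear Y -> Y} :=
  HB.pack (a n) (GRing.isLinear.Build R Y Y *:%R _ (linA n)).
pose B' n : {linear Y -> Y} :=
  HB.pack (b n) (GRing.isLinear.Build R Y Y *:%R _ (linB n)).
exists A', B', (fun n => C ^+ n.+1); split=> [n|n y|n m y].
- by rewrite exprn_gt0// (lt_le_trans _ C1).
- have C0 : 0 <= C by rewrite (le_trans _ C1).
  split; rewrite -/(a n y) -/(b n y).
  + elim: n => [|n IH]; first by rewrite expr1; case: (bd false y).
    rewrite [C ^+ _]exprS -mulrA; apply: le_trans (ler_wpM2l C0 IH).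
    by case: (bd true (a n y)).
  + have h : `|iter n (B true) y| <= C ^+ n * `|y|.
      elim: n => [|n IH] /=; first by rewrite expr0 mul1r.
      rewrite exprS -mulrA; apply: le_trans (ler_wpM2l C0 IH).
      by case: (bd true (iter n (B true) y)).
    rewrite exprS -mulrA; apply: le_trans (ler_wpM2l C0 h).
    by case: (bd false (iter n (B true) y)).
- rewrite -/(a m y) -/(b n (a m y)).
  have b0 k : b k 0 = 0 by rewrite -[b k]/(B' k : _ -> _) linear0.
  elim: m n => [|m IH] [|n] //=; rewrite ?eqSS.
  + by rewrite /b /a /= BA.
  + by rewrite /b iterSr /a/= BA/= -/(b n 0) b0.
  + by rewrite /b /a /= BA.
  + by rewrite /b iterSr -/(b n _) /a /= BA /=; exact: IH.
Qed.

End Copies.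

(** * Gluing rescaled copies of a uniform embedding *)

Section Gluing.
Context {R : realType}.

(** Completeness, in the only form used for the gluing. *)
Definition abs_series_cvg (Y : normedModType R) :=
  forall u : nat -> Y, cvgn [normed series u] -> cvgn (series u).

(** In a normed space two points at distance at most [k] are joined by [k]
    steps of length at most one along the segment between them. *)
Lemma norm_chain (X Y : normedModType R) (h : X -> Y) (c : R) (k : nat) x y :
  (forall u v, `|u - v| <= 1 -> `|h u - h v| <= c) ->
  `|x - y| <= k%:R -> `|h x - h y| <= k%:R * c.
Proof.
move=> hc; elim: k x => [|k IH] x xy.
  have /eqP : `|x - y| = 0 by apply/le_anti; rewrite xy normr_ge0.
  by rewrite normr_eq0 subr_eq0 => /eqP->; rewrite subrr normr0 mul0r.
pose t : R := k.+1%:R^-1.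
have t0 : 0 < t by rewrite invr_gt0 ltr0n.
have tk : t * k.+1%:R = 1 by rewrite mulVf// pnatr_eq0.
pose z := x - t *: (x - y).
have xz : `|x - z| <= 1.
  rewrite /z opprB addrC subrK normrZ gtr0_norm// -tk.
  by rewrite ler_wpM2l// ltW.
have zy : `|z - y| <= k%:R.
  have -> : z - y = (k%:R * t) *: (x - y).
    have -> : k%:R * t = 1 - t.
      by move: tk; rewrite -[in X in X -> _]natr1; lra.
    by rewrite scalerBl scale1r /z addrAC.
  have kt0 : 0 <= k%:R * t by rewrite mulr_ge0// ltW.
  rewrite normrZ ger0_norm// -mulrA -[leRHS]mulr1 ler_wpM2l//.
  by rewrite -tk ler_wpM2l// ltW.
rewrite -[h x](subrK (h z)) -addrA (le_trans (ler_normD _ _))//.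
by rewrite -[k.+1]add1n natrD mulrDl mul1r lerD// ?hc// IH.
Qed.

Lemma geometric_sum_le (c : nat -> R) (k : R) (M n : nat) : 0 <= k ->
  (forall m, c m <= k * 2^-1 ^+ m) ->
  \sum_(m < M + n) c m <= \sum_(m < M) c m + 2 * k * 2^-1 ^+ M.
Proof.
move=> k0 ck.
suff : \sum_(m < M + n) c m <=
    \sum_(m < M) c m + 2 * k * (2^-1 ^+ M - 2^-1 ^+ (M + n)).
  move/le_trans; apply; rewrite lerD2l ler_wpM2l ?mulr_ge0//.
  by rewrite gerBl exprn_ge0.
elim: n => [|n IH]; first by rewrite addn0 subrr mulr0 addr0.
rewrite addnS big_ord_recr /=.
have := ck (M + n)%N; rewrite exprS; move: IH; lra.
Qed.

Lemma norm_lim_series_le (Y : normedModType R) (u : nat -> Y) (l : Y)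
    (k : R) (M : nat) : 0 <= k ->
  series u n @[n --> \oo] --> l ->
  (forall m, `|u m| <= k * 2^-1 ^+ m) ->
  `|l| <= \sum_(m < M) `|u m| + 2 * k * 2^-1 ^+ M.
Proof.
move=> k0 ul uk.
have nul : `|series u n| @[n --> \oo] --> `|l| by exact: cvg_norm.
apply: (cvgr_to_le nul).
near=> n.
have Mn : (M <= n)%N by near: n; exact: nbhs_infty_ge.
rewrite /series/= big_mkord (le_trans (ler_norm_sum _ _ _))//.
rewrite -(subnKC Mn); exact: (@geometric_sum_le (fun i => `|u i|)).
Unshelve. all: by end_near.
Qed.

(** The weights [w n] are chosen before the scales [s n], so that the latter
    absorb both the weights and the norms of the embeddings. *)
Theorem strong_of_uniform (X Y : normedModType R) :
  abs_series_cvg Y -> absorbs_square Y ->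
  (exists f : X -> Y, uniform_embedding f) ->
  exists g : X -> Y, strong_embedding g.
Proof.
move=> Ycomp /countable_copies[A [B [C [C0 ABbd BA]]]] [f].
move=> /uniform_embeddingP[fu fl].
pose w n : R := n.+1%:R * C n.
have w0 n : 0 < w n by rewrite mulr_gt0// ltr0n.
have /choice[s hs] : forall n, exists sn, 0 < sn /\
    forall x y, `|x - y| <= sn -> C n * w n * `|f x - f y| <= 2^-1 ^+ n.
  move=> n.
  have Cw : 0 < C n * w n by rewrite mulr_gt0.
  have e0 : 0 < (C n * w n)^-1 * 2^-1 ^+ n.
    by rewrite mulr_gt0// ?invr_gt0// exprn_gt0.
  have [d d0 df] := fu _ e0; exists d; split=> // x y /df.
  by rewrite mulrC ler_pdivlMr// mulrC.
have s0 n : 0 < s n by case: (hs n).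
pose h n x := A n (w n *: (f (s n *: x) - f 0)).
have hB n x y : h n x - h n y = A n (w n *: (f (s n *: x) - f (s n *: y))).
  by rewrite /h -linearB -scalerBr opprB addrA subrK.
have hle n x y : `|h n x - h n y| <= C n * w n * `|f (s n *: x) - f (s n *: y)|.
  rewrite hB; have [+ _] := ABbd n (w n *: (f (s n *: x) - f (s n *: y))).
  by rewrite normrZ gtr0_norm// mulrA.
have h1 n x y : `|x - y| <= 1 -> `|h n x - h n y| <= 2^-1 ^+ n.
  move=> xy; apply: (le_trans (hle n x y)).
  have [_ ] := hs n; apply; rewrite -scalerBr normrZ gtr0_norm//.
  by rewrite -[leRHS]mulr1 ler_wpM2l// ltW.
have hk (k : nat) n x y : `|x - y| <= k%:R ->
  `|h n x - h n y| <= k%:R * 2^-1 ^+ n by apply: norm_chain; exact: h1.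
have h0 n : h n 0 = 0 by rewrite /h scaler0 subrr scaler0 linear0.
have nat_ub (t : R) : exists k : nat, t <= k%:R.
  by exists (Num.bound `|t|); rewrite (le_trans (ler_norm _))// ltW// archi_boundP.
have hcvg x : cvgn (series (h ^~ x)).
  apply: Ycomp; have [k xk] := nat_ub `|x|.
  apply: (@series_le_cvg _ _ (geometric k%:R 2^-1)) => [n|n|n|].
  - exact: normr_ge0.
  - by rewrite /geometric/= mulr_ge0// exprn_ge0.
  - rewrite /geometric/= -[h n x]subr0 -(h0 n); apply: hk.
    by rewrite subr0.
  - apply: is_cvg_geometric_series; rewrite ger0_norm//; lra.
pose g x := limn (series (h ^~ x)).
have gB x y : series (fun n => h n x - h n y) n @[n --> \oo] --> g x - g y.
  have -> : series (fun n => h n x - h n y) =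
      (fun n => series (h ^~ x) n - series (h ^~ y) n).
    by apply/funext => n; rewrite /series/= sumrB.
  by apply: cvgB; exact: hcvg.
have gle (k : nat) M x y : `|x - y| <= k%:R ->
    `|g x - g y| <= \sum_(m < M) `|h m x - h m y| + 2 * k%:R * 2^-1 ^+ M.
  move=> xy; apply: (norm_lim_series_le _ _ (gB x y)) => // m; exact: hk.
(* [B n] kills all terms of a partial sum but the [n]-th one, at the cost of a
   factor [C n] that the weight [w n] compensates. *)
have gge n x y : n.+1%:R * `|f (s n *: x) - f (s n *: y)| <= `|g x - g y|.
  have Cn := C0 n; rewrite -(ler_pM2l Cn).
  have ngB : C n * `|series (fun n => h n x - h n y) k| @[k --> \oo]
      --> C n * `|g x - g y|.
    by apply: cvgMl_tmp; apply: cvg_norm; exact: gB.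
  apply: (cvgr_to_ge ngB).
  near=> k.
  have nk : (n < k)%N by near: k; exact: nbhs_infty_gt.
  have [_ ] := ABbd n (series (fun n => h n x - h n y) k).
  apply: le_trans; rewrite /series/= big_mkord linear_sum/=.
  rewrite (bigD1 (Ordinal nk))//= big1 => [|i]; last first.
    rewrite -val_eqE/= => ik.
    by rewrite hB BA eq_sym (negbTE ik).
  by rewrite addr0 hB BA eqxx normrZ gtr0_norm// mulrA [C n * _]mulrC.
exists g; split; [split|].
- apply/coarseP => t t0; have [k tk] := nat_ub t.
  exists (2 * k%:R) => x y xy.
  have := @gle k 0 x y (le_trans xy tk).
  by rewrite big_ord0 add0r expr0 mulr1.
- apply/expandingP => c; have [r r0 rf] := fl 1 ltr01.
  have [n cn] := nat_ub (c / r).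
  exists (s n)^-1 => x y xy.
  apply: le_trans (gge n x y).
  have fr : r <= `|f (s n *: x) - f (s n *: y)|.
    apply: rf; rewrite -scalerBr normrZ gtr0_norm//.
    by rewrite mulrC -ler_pdivrMr// div1r.
  apply: (@le_trans _ _ (n%:R * r)); first by rewrite -ler_pdivrMr.
  by rewrite ler_pM// ?ler_nat// ltW.
- apply/uniform_embeddingP; split=> [e e0|t t0].
    have [M Me] : exists M, 2 * 2^-1 ^+ M <= e / 2 :> R.
      have [k ke] := nat_ub (4 / e); exists k.
      have k2 : k%:R <= 2 ^+ k :> R.
        by rewrite -natrX ler_nat ltnW// ltn_expl.
      rewrite exprVn ler_pdivrMr ?exprn_gt0//.
      have : 4 <= e * 2 ^+ k.
        by rewrite -ler_pdivrMl// mulrC (le_trans ke).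
      lra.
    have [d d0 dM] : exists2 d, 0 < d & forall x y, `|x - y| <= d ->
        \sum_(m < M) `|h m x - h m y| <= e / 2.
      have : 0 < e / 2 by rewrite divr_gt0.
      move: (e / 2); elim: M {Me} => [|M IH] e' e'0.
        by exists 1 => // x y _; rewrite big_ord0 ltW.
      have e2 : 0 < e' / 2 by rewrite divr_gt0.
      have [d d0 dh] := IH _ e2.
      have Cw : 0 < C M * w M by rewrite mulr_gt0.
      have e3 : 0 < (C M * w M)^-1 * (e' / 2) by rewrite mulr_gt0// invr_gt0.
      have [d' d'0 df] := fu _ e3.
      exists (Num.min d (d' / s M)); first by rewrite lt_min d0 divr_gt0.
      move=> x y; rewrite le_min => /andP[xy xy'].
      rewrite big_ord_recr/= [e' in leRHS]splitr lerD ?dh//.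
      apply: (le_trans (hle M x y)); rewrite -ler_pdivlMl// df//.
      by rewrite -scalerBr normrZ gtr0_norm// mulrC -ler_pdivlMr.
    exists (Num.min d 1); first by rewrite lt_min d0 ltr01.
    move=> x y; rewrite le_min => /andP[xy xy1].
    apply: (le_trans (@gle 1 M x y xy1)).
    by rewrite [e]splitr lerD ?dM// mulr1.
  have [r r0 rf] := fl (s 0%N * t) ltac:(by rewrite mulr_gt0).
  exists r => // x y xy; apply: le_trans (gge 0%N x y).
  rewrite mul1r; apply: rf.
  by rewrite -scalerBr normrZ gtr0_norm// ler_wpM2l// ltW.
Unshelve. all: by end_near.
Qed.

End Gluing.

(** * Finitely supported sequences and block families *)

Section C00Facts.
Context {R : realType}.
Implicit Types (x y : c00 R) (D E F : {fset nat}).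

Lemma c00_ext x y : (forall i, x i = y i) -> x = y.
Proof. by move=> xy; apply/val_inj/funext. Qed.

Lemma restrE E x i : restr E x i = if i \in E then x i else 0.
Proof. by []. Qed.

Lemma restr_restr E F x : restr E (restr F x) = restr (E `&` F)%fset x.
Proof.
by apply: c00_ext => i; rewrite !restrE !inE; case: (i \in E); case: (i \in F).
Qed.

Lemma restr_sub E F x : (E `<=` F)%fset -> restr E (restr F x) = restr E x.
Proof. by move=> /fsetIidPl EF; rewrite restr_restr EF. Qed.

Definition supported D x := forall i, i \notin D -> x i = 0.

Lemma supported_restr D E x :
  supported D x -> supported (E `&` D)%fset (restr E x).
Proof.
move=> Dx i; rewrite !inE restrE; case: (i \in E) => //= iD; exact: Dx.
Qed.

Lemma restr_id D E x : supported D x -> (D `<=` E)%fset -> restr E x = x.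
Proof.
move=> Dx /fsubsetP DE; apply: c00_ext => i; rewrite restrE.
by case: ifPn => // iE; rewrite Dx//; apply: contra iE; exact: DE.
Qed.

Lemma restr_eq0 E x : (forall i, i \in E -> x i = 0) -> restr E x = 0.
Proof. by move=> Ex; apply: c00_ext => i; rewrite restrE; case: ifP => // /Ex. Qed.

Lemma ex_support x : exists D, supported D x.
Proof.
case: x => f /= /[dup] /asboolP[n fn] ff.
exists [fset i in iota 0 n]%fset => i; rewrite inE mem_iota add0n/= -leqNgt.
exact: fn.
Qed.

End C00Facts.

Section Blocks.
Implicit Types (D E F : {fset nat}) (Es : seq {fset nat}).

Lemma fset_ltP E F : reflect (forall i j, i \in E -> j \in F -> (i < j)%N)
  (fset_lt E F).
Proof.
apply: (iffP idP) => [/forallP EF i j iE jF|EF].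
  by have /forallP/(_ [` jF]%fset) := EF [` iE]%fset.
by apply/forallP => i; apply/forallP => j; exact: EF (valP i) (valP j).
Qed.

Lemma fset_lt_sub E E' F F' : (E' `<=` E)%fset -> (F' `<=` F)%fset ->
  fset_lt E F -> fset_lt E' F'.
Proof.
move=> /fsubsetP EE /fsubsetP FF /fset_ltP EF; apply/fset_ltP => i j iE jF.
by apply: EF; [exact: EE|exact: FF].
Qed.

Lemma blocks_filter Es :
  pairwise fset_lt Es -> blocks [seq E <- Es | E != fset0].
Proof. by move=> Es_lt; rewrite /blocks filter_all pairwise_filter. Qed.

Lemma blocks_cat s t : blocks (s ++ t) ->
  [/\ blocks s, blocks t & forall E F, E \in s -> F \in t -> fset_lt E F].
Proof.
rewrite /blocks all_cat pairwise_cat.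
move=> /andP[/andP[-> ->] /and3P[/allrelP st -> ->]]; split=> //.
Qed.

(** Blocks are nonempty and successive, so the minimum increases by at least one
    from each block to the next. *)
Lemma block_nth_ge Es c k i : blocks Es ->
  (forall j, j \in head fset0 Es -> (c <= j)%N) ->
  i \in nth fset0 Es k -> (c + k <= i)%N.
Proof.
elim: Es c k => [|E Es IH] c [|k] //=; rewrite ?nth_nil ?inE//.
  by move=> _ Ec /Ec; rewrite addn0.
rewrite /blocks /= => /andP[/andP[E0 Es0] /andP[EEs Es_lt]] Ec iE.
rewrite addnS -addSn; apply: (IH c.+1 k) => //; first by rewrite /blocks Es0.
case: Es EEs {IH iE Es0 Es_lt} => [|F Es] //= /andP[/fset_ltP EF _] j jF.
by have /fset0Pn[e eE] := E0; exact: leq_ltn_trans (Ec _ eE) (EF _ _ eE jF).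
Qed.

(** The induction used for all norm inequalities: [D] bounds the support of a
    sequence, and restricting to a set that does not contain [D] shrinks it. *)
Lemma fset_proper_ind (P : {fset nat} -> Prop) :
  (forall D, (forall E, ~~ (D `<=` E)%fset -> P (E `&` D)%fset) -> P D) ->
  forall D, P D.
Proof.
move=> Pind D; have [n] := ubnP #|` D|; elim: n D => // n IH D Dn.
apply: Pind => E DE; apply: IH; rewrite -ltnS; apply: leq_trans Dn.
rewrite ltnS; apply: fproper_ltn_card; rewrite fproperE fsubsetIr/=.
by apply: contra DE => /fsubset_trans; apply; exact: fsubsetIl.
Qed.

End Blocks.

(** * Norms defined by an implicit equation *)

Section ImplicitNorm.
Context {R : realType}.
Implicit Types (x y : c00 R) (D E F : {fset nat}) (Es : seq {fset nat}).

(** The common shape of the two norms: [N x] is the maximum of the sup norm and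
    of the sums over families allowed by [adm], damped by a factor [theta]
    depending on the number of blocks and bounded by [r < 1]. *)
Record implicit_norm (adm : seq {fset nat} -> Prop) (theta : nat -> R) (r : R)
    (N : c00 R -> R) : Prop := ImplicitNorm {
  inorm_norm : is_norm N;
  inorm_lt1 : r < 1;
  inorm_adm : forall Es, adm Es -> blocks Es;
  inorm_theta : forall Es, adm Es -> 0 < theta (size Es) <= r;
  inorm_coord : forall x i, `|x i| <= N x;
  inorm_blocks : forall x Es, adm Es ->
    theta (size Es) * block_sum N x Es <= N x;
  inorm_least : forall x c, (forall i, `|x i| <= c) ->
    (forall Es, adm Es -> theta (size Es) * block_sum N x Es <= c) ->
    N x <= c }.

Variables (adm : seq {fset nat} -> Prop) (theta : nat -> R) (r : R).
Variable N : c00 R -> R.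
Hypothesis Nimp : implicit_norm adm theta r N.

Lemma inorm0 : N 0 = 0.
Proof.
have [_ /(_ 0 0) NZ _] := inorm_norm Nimp.
by move: NZ; rewrite scale0r normr0 mul0r.
Qed.

Lemma inorm_ge0 x : 0 <= N x.
Proof. exact: le_trans (normr_ge0 _) (inorm_coord Nimp x 0%N). Qed.

Lemma block_sum_filter x Es :
  block_sum N x [seq E <- Es | E != fset0] = block_sum N x Es.
Proof.
rewrite /block_sum big_filter [RHS](bigID (fun E => E != fset0))/=.
rewrite [X in _ + X]big1 ?addr0// => E; rewrite negbK => /eqP->.
by rewrite restr_eq0 ?inorm0// => i; rewrite inE.
Qed.

Lemma block_sum_ge0 x Es : 0 <= block_sum N x Es.
Proof. by apply: sumr_ge0 => E _; exact: inorm_ge0. Qed.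

(** If a block of a family contains the whole support, then the other blocks
    contribute nothing and the damped sum is at most [r * N x]; since [r < 1],
    such a family is irrelevant for the supremum defining [N x]. Only restrictions
    of [x] to smaller supports remain, which makes induction possible. *)
Lemma inorm_least_proper D x c : supported D x -> (forall i, `|x i| <= c) ->
  (forall Es, adm Es -> (forall E, E \in Es -> ~~ (D `<=` E)%fset) ->
     theta (size Es) * block_sum N x Es <= c) ->
  N x <= c.
Proof.
move=> Dx xc Esc; rewrite leNgt; apply/negP => cN.
have c0 : 0 <= c := le_trans (normr_ge0 _) (xc 0%N).
have N0 : 0 < N x := le_lt_trans c0 cN.
suff : N x <= Num.max c (r * N x).
  by rewrite le_max !leNgt cN/= gtr_pMl// (inorm_lt1 Nimp).
apply: (inorm_least Nimp) => [i|Es Es_adm]; first by rewrite le_max xc.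
have [/hasP[E EEs DE]|/hasPn h] := boolP (has (fun E => D `<=` E)%fset Es);
  last by rewrite le_max Esc.
have /andP[t0 tr] := inorm_theta Nimp Es_adm.
rewrite le_max; apply/orP; right.
apply: (@le_trans _ _ (theta (size Es) * N x)); last by rewrite ler_pM2r.
rewrite ler_wpM2l ?(ltW t0)//.
have := inorm_adm Nimp Es_adm; case/splitPr: EEs => s t /andP[_].
rewrite pairwise_cat/= => /and3P[/allrelP st _ /andP[/allP Et _]].
rewrite /block_sum big_cat big_cons/= !big_seq !big1 ?addr0 ?add0r.
- by rewrite (restr_id Dx).
- move=> F /Et /fset_ltP EF; rewrite restr_eq0 ?inorm0// => i iF.
  apply: Dx; apply/negP => /(fsubsetP DE) iE.
  by have := EF _ _ iE iF; rewrite ltnn.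
- move=> F Fs; rewrite restr_eq0 ?inorm0// => i iF.
  apply: Dx; apply/negP => /(fsubsetP DE) iE.
  have /fset_ltP := st F E Fs (mem_head _ _).
  by move=> /(_ _ _ iF iE); rewrite ltnn.
Qed.

Lemma le_inorm_restr E x : N (restr E x) <= N x.
Proof.
have [D] := ex_support x; move: D x E.
apply: fset_proper_ind => D IH x E Dx.
have DEx : supported D (restr E x).
  by move=> i iD; rewrite restrE Dx// if_same.
apply: (inorm_least_proper DEx) => [i|Es Es_adm EsD].
  rewrite restrE; case: ifP => _; first exact: (inorm_coord Nimp).
  by rewrite normr0 inorm_ge0.
apply: le_trans (inorm_blocks Nimp x Es_adm).
have /andP[t0 _] := inorm_theta Nimp Es_adm.
rewrite ler_wpM2l ?(ltW t0)// /block_sum !big_seq ler_sum// => F FEs.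
rewrite restr_restr fsetIC -restr_restr.
exact: (IH _ (EsD _ FEs) _ _ (supported_restr Dx)).
Qed.

End ImplicitNorm.

(** * Sequences supported on the even or on the odd indices *)

Section ParityMaps.
Context {R : realType}.
Implicit Types (x y : c00 R) (b c : bool) (E F : {fset nat}).

Fact shrink_fin_supp b x : (fun i => x (b + i.*2)%N) \in @fin_supp R.
Proof.
case: x => f /= /asboolP[n fn]; apply/asboolP; exists n => i ni.
by apply: fn; lia.
Qed.

Definition shrink b x : c00 R := C00 (shrink_fin_supp b x).

Fact stretch_fin_supp b x :
  (fun k => if odd k == b then x k./2 else 0) \in @fin_supp R.
Proof.
case: x => f /= /asboolP[n fn]; apply/asboolP; exists n.*2 => i ni.
by case: ifP => // _; apply: fn; lia.
Qed.

Definition stretch b x : c00 R := C00 (stretch_fin_supp b x).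

Lemma shrink_linear b : linear (shrink b).
Proof. by move=> a x y; apply: c00_ext. Qed.

Lemma stretch_linear b : linear (stretch b).
Proof.
move=> a x y; apply: c00_ext => i; rewrite /stretch/=.
change ((if odd i == b then (a *: x + y) i./2 else 0) =
  a *: (if odd i == b then x i./2 else 0) + (if odd i == b then y i./2 else 0)).
by case: ifP => // _; rewrite scaler0 addr0.
Qed.

Lemma shrink_stretch b c x :
  shrink b (stretch c x) = if b == c then x else 0.
Proof.
apply: c00_ext => i; rewrite /shrink/stretch/= oddD odd_double addbF.
rewrite half_bit_double; case: b c => -[]//.
Qed.

Definition fset_stretch b E : {fset nat} := [fset (b + i.*2)%N | i in E]%fset.

Definition fset_shrink b E : {fset nat} :=
  [fset k./2 | k in E & odd k == b]%fset.

Lemma mem_fset_stretch b E i : ((b + i.*2)%N \in fset_stretch b E) = (i \in E).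
Proof.
apply/imfsetP/idP => [[j jE ij]|iE]; last by exists i.
suff -> : i = j by []. 
by move: ij; lia.
Qed.

Lemma mem_fset_shrink b E i : (i \in fset_shrink b E) = ((b + i.*2)%N \in E).
Proof.
apply/imfsetP/idP => [[k /=]|iE].
  by rewrite inE => /andP[kE /eqP <-] ->; rewrite odd_double_half.
exists (b + i.*2)%N; rewrite /= ?inE ?half_bit_double// iE /=.
by rewrite oddD odd_double addbF oddb.
Qed.

Lemma restr_shrink b E x :
  restr E (shrink b x) = shrink b (restr (fset_stretch b E) x).
Proof.
by apply: c00_ext => i; rewrite /restr/shrink/= mem_fset_stretch.
Qed.

Lemma restr_stretch b E x :
  restr E (stretch b x) = stretch b (restr (fset_shrink b E) x).
Proof.
apply: c00_ext => k; rewrite /restr/stretch/= mem_fset_shrink.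
case: eqP => [<-|_]; last by rewrite if_same.
by rewrite odd_double_half.
Qed.

Lemma supported_stretch b D x :
  supported D x -> supported (fset_stretch b D) (stretch b x).
Proof.
move=> Dx k kD; rewrite /stretch/=; case: eqP => // kb; apply: Dx.
by rewrite -(mem_fset_stretch b) -kb odd_double_half kb.
Qed.

Lemma fset_stretch_sub b D E :
  (fset_stretch b D `<=` E)%fset = (D `<=` fset_shrink b E)%fset.
Proof.
apply/fsubsetP/fsubsetP => DE i iD.
  by rewrite mem_fset_shrink DE// mem_fset_stretch.
by move: iD => /imfsetP[j /= /DE]; rewrite mem_fset_shrink => jE ->.
Qed.

Lemma fset_stretch_lt b E F :
  fset_lt E F -> fset_lt (fset_stretch b E) (fset_stretch b F).
Proof.
move=> /fset_ltP EF; apply/fset_ltP => _ _ /imfsetP[i /= iE ->] /imfsetP[j /= jF ->].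
by have := EF _ _ iE jF; lia.
Qed.

Lemma fset_shrink_lt b E F :
  fset_lt E F -> fset_lt (fset_shrink b E) (fset_shrink b F).
Proof.
move=> /fset_ltP EF; apply/fset_ltP => i j.
by rewrite !mem_fset_shrink => iE jF; have := EF _ _ iE jF; lia.
Qed.

Lemma blocks_stretch b Es : blocks Es -> blocks (map (fset_stretch b) Es).
Proof.
move=> /andP[/allP Es0 Es_lt]; apply/andP; split.
  apply/allP => _ /mapP[E /Es0 /fset0Pn[i iE] ->]; apply/fset0Pn.
  by exists (b + i.*2)%N; rewrite mem_fset_stretch.
rewrite pairwise_map; apply: sub_pairwise Es_lt => E F; exact: fset_stretch_lt.
Qed.

End ParityMaps.

(** * Shrinking is a contraction *)

Section NormShrink.
Context {R : realType}.
Variables (adm : seq {fset nat} -> Prop) (theta : nat -> R) (r : R).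
Variable N : c00 R -> R.
Hypothesis Nimp : implicit_norm adm theta r N.
Hypothesis adm_stretch :
  forall b Es, adm Es -> adm (map (fset_stretch b) Es).

(** The blocks of a family for [shrink b x] correspond to blocks of [x] lying
    further to the right, which form an admissible family again. *)
Lemma le_inorm_shrink b x : N (shrink b x) <= N x.
Proof.
have [D] := ex_support (shrink b x); move: D x.
apply: fset_proper_ind => D IH x Dx.
apply: (inorm_least_proper Nimp Dx) => [i|Es Es_adm EsD].
  exact: (inorm_coord Nimp x (b + i.*2)%N).
apply: le_trans (inorm_blocks Nimp x (adm_stretch b Es_adm)).
have /andP[t0 _] := inorm_theta Nimp Es_adm.
rewrite size_map ler_wpM2l ?(ltW t0)// /block_sum big_map !big_seq.
apply: ler_sum => E EEs; rewrite restr_shrink; apply: (IH _ (EsD _ EEs)).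
by rewrite -restr_shrink; exact: supported_restr.
Qed.

End NormShrink.

(** * The Tsirelson and Schlumprecht norms as implicit norms *)

Section Specializations.
Context {R : realType}.
Implicit Types (N : c00 R -> R) (x : c00 R).

Lemma supnorm_le x (c : R) :
  (supnorm x <= c%:E)%E <-> forall i, `|x i| <= c.
Proof.
split=> [h i|h].
  by rewrite -lee_fin; apply: le_trans h; apply: ereal_sup_ubound; exists i.
by apply: ge_ereal_sup => _ [i _ <-]; rewrite lee_fin.
Qed.

Lemma scaled_sup_le (I : Type) (P : set I) (F : I -> R) (t c : R) : 0 < t ->
  (t%:E * ereal_sup [set (F i)%:E | i in P] <= c%:E)%E <->
  forall i, P i -> t * F i <= c.
Proof.
move=> t0; rewrite -ereal_sup_pZl//; split=> [h i Pi|h].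
  rewrite -lee_fin; apply: le_trans h; apply: ereal_sup_ubound.
  by exists (F i)%:E => //; exists i.
by apply: ge_ereal_sup => _ [_ [i Pi <-] <-]; rewrite -EFinM lee_fin h.
Qed.

Lemma implicit_normP adm theta r N : is_norm N -> r < 1 ->
  (forall Es, adm Es -> blocks Es) ->
  (forall Es, adm Es -> 0 < theta (size Es) <= r) ->
  (forall x c, N x <= c <-> (forall i, `|x i| <= c) /\
    forall Es, adm Es -> theta (size Es) * block_sum N x Es <= c) ->
  implicit_norm adm theta r N.
Proof.
move=> Nn r1 admb admt h; split=> // [x i|x|x c xc Esc].
- by have [+ _] := h x (N x) => /(_ (lexx _))[].
- by have [+ _] := h x (N x) => /(_ (lexx _))[].
- by apply/h.
Qed.

Lemma admissible_half Es : admissible Es -> 0 < (2^-1 : R) <= 2^-1.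
Proof. by rewrite lexx andbT. Qed.

Lemma half_lt1 : 2^-1 < 1 :> R. Proof. by lra. Qed.

Lemma admissible_blocks Es : admissible Es -> blocks Es.
Proof. by case. Qed.

Lemma tsirelson_implicit N :
  tsirelson_norm N -> implicit_norm admissible (fun=> 2^-1) 2^-1 N.
Proof.
move=> [Nn NE].
apply: implicit_normP half_lt1 admissible_blocks admissible_half _ => // x c.
rewrite -lee_fin NE ge_max; split=> [/andP[]|[xc Esc]].
  by move=> /supnorm_le xc; rewrite scaled_sup_le.
by apply/andP; split; [exact/supnorm_le|rewrite scaled_sup_le].
Qed.

Definition schlumprecht_adm (Es : seq {fset nat}) :=
  blocks Es /\ (2 <= size Es)%N.

Lemma schlumprecht_adm_blocks Es : schlumprecht_adm Es -> blocks Es.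
Proof. by case. Qed.

Definition schlumprecht_theta (k : nat) : R := (log2 k.+1%:R)^-1.

Lemma log2_gt0 k : (2 <= k)%N -> 0 < log2 k%:R :> R.
Proof. by move=> k2; rewrite divr_gt0// ln_gt0// ltr1n. Qed.

Lemma schlumprecht_theta_anti k l : (1 <= k)%N -> (k <= l)%N ->
  schlumprecht_theta l <= schlumprecht_theta k.
Proof.
move=> k1 kl; rewrite /schlumprecht_theta lef_pV2 ?posrE ?log2_gt0//; last lia.
by rewrite ler_pM2r ?invr_gt0 ?ln_gt0 ?ltr1n// ler_ln ?posrE// ler_nat.
Qed.

Lemma schlumprecht_theta2_lt1 : schlumprecht_theta 2 < 1.
Proof.
have l2 : 0 < ln 2 :> R by rewrite ln_gt0// ltr1n.
rewrite invf_lt1 ?log2_gt0// /log2 ltr_pdivlMr// mul1r.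
by rewrite ltr_ln ?posrE// ltr_nat.
Qed.

Lemma schlumprecht_adm_theta Es : schlumprecht_adm Es ->
  0 < schlumprecht_theta (size Es) <= schlumprecht_theta 2.
Proof.
move=> [_ Es2]; rewrite schlumprecht_theta_anti// andbT.
by rewrite invr_gt0 log2_gt0// ltnS ltnW.
Qed.

Lemma schlumprecht_implicit N :
  schlumprecht_norm N -> implicit_norm schlumprecht_adm schlumprecht_theta
    (schlumprecht_theta 2) N.
Proof.
move=> [Nn NE]; apply: implicit_normP schlumprecht_theta2_lt1
  schlumprecht_adm_blocks schlumprecht_adm_theta _ => // x c.
rewrite -lee_fin NE ge_max; split=> [/andP[/supnorm_le xc Sc]|[xc Esc]].
  split=> // Es [Esb Es2].
  have := scaled_sup_le [set Fs | blocks Fs /\ size Fs = size Es]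
    (block_sum N x) c.
  move=> /(_ (schlumprecht_theta (size Es))) [|h _].
    by rewrite invr_gt0 log2_gt0// ltnS ltnW.
  apply: h => //; apply: le_trans Sc; apply: ereal_sup_ubound.
  by exists (size Es).
apply/andP; split; first exact/supnorm_le.
apply: ge_ereal_sup => _ [k k2 <-]; rewrite scaled_sup_le.
  by move=> Es [Esb Esk]; rewrite -Esk; apply: Esc; split=> //; rewrite Esk.
by rewrite invr_gt0 log2_gt0// ltnS ltnW.
Qed.

Lemma schlumprecht_adm_stretch b Es :
  schlumprecht_adm Es -> schlumprecht_adm (map (fset_stretch b) Es).
Proof. by move=> [Esb Es2]; split; [exact: blocks_stretch|rewrite size_map]. Qed.

Lemma admissible_stretch b Es :
  admissible Es -> admissible (map (fset_stretch b) Es).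
Proof.
move=> [Esb Es0 Esh]; split; [exact: blocks_stretch|by rewrite size_map|].
case: Es Esb Es0 Esh => //= E Es _ _ h i /imfsetP[j /= /h jE ->].
by rewrite size_map; lia.
Qed.

End Specializations.

(** * Stretching for the Schlumprecht norm *)

Section SchlumprechtStretch.
Context {R : realType}.
Variable N : c00 R -> R.
Hypothesis Nimp : implicit_norm schlumprecht_adm schlumprecht_theta
    (schlumprecht_theta 2) N.

(** Dropping the empty sets of a family decreases its size, hence increases the
    factor [schlumprecht_theta]. If a single block remains, the family is no longer
    admissible, but the norm of one restriction is bounded directly. *)
Lemma schlumprecht_sum_le x Es : pairwise fset_lt Es -> (2 <= size Es)%N ->
  schlumprecht_theta (size Es) * block_sum N x Es <= N x.
Proof.
move=> Es_lt Es2; have Esb := blocks_filter Es_lt.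
have t0 k : (1 <= k)%N -> 0 <= schlumprecht_theta k :> R.
  by move=> k1; rewrite invr_ge0 ltW// log2_gt0.
have t1 : schlumprecht_theta (size Es) <= 1 :> R.
  apply: le_trans (ltW schlumprecht_theta2_lt1).
  exact: schlumprecht_theta_anti.
rewrite -(block_sum_filter Nimp).
set Fs := [seq E <- Es | _] in Esb *.
have Fsz : (size Fs <= size Es)%N by rewrite size_filter count_size.
case: (ltngtP (size Fs) 1%N) => [F0|F2|/eqP].
- have -> : Fs = [::] by apply/size0nil; lia.
  by rewrite /block_sum big_nil mulr0 (inorm_ge0 Nimp).
- apply: le_trans (inorm_blocks Nimp x (conj Esb F2)).
  rewrite ler_wpM2r ?(block_sum_ge0 Nimp)//.
  by apply: schlumprecht_theta_anti => //; lia.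
- case: Fs {Esb Fsz} => [//|E [|//]] _; rewrite /block_sum big_seq1.
  apply: le_trans (le_inorm_restr Nimp E x).
  by rewrite ler_piMl// (inorm_ge0 Nimp).
Qed.

(** Pulling a block family back along [i |-> 2i + b] gives a successive family,
    in which some sets may have become empty. *)
Lemma schlumprecht_stretch_le b x : N (stretch b x) <= N x.
Proof.
have [D] := ex_support x; move: D x.
apply: fset_proper_ind => D IH x Dx.
apply: (inorm_least_proper Nimp (supported_stretch (b := b) Dx)).
  move=> k; rewrite /stretch/=; case: ifP => _; last first.
    by rewrite normr0 (inorm_ge0 Nimp).
  exact: (inorm_coord Nimp).
move=> Es Es_adm EsD; have [/andP[_ Es_lt] Es2] := Es_adm.
have /andP[t0 _] := @schlumprecht_adm_theta R _ Es_adm.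
apply: le_trans (@schlumprecht_sum_le x (map (fset_shrink b) Es) _ _).
- rewrite size_map ler_wpM2l ?(ltW t0)// /block_sum big_map !big_seq.
  apply: ler_sum => E EEs; rewrite restr_stretch.
  apply: (IH (fset_shrink b E)); last exact: supported_restr.
  by rewrite -fset_stretch_sub EsD.
- rewrite pairwise_map; apply: sub_pairwise Es_lt => E F.
  exact: fset_shrink_lt.
- by rewrite size_map.
Qed.

End SchlumprechtStretch.

(** * Stretching for the Tsirelson norm *)

Section TsirelsonStretch.
Context {R : realType}.
Implicit Types (x : c00 R) (D E F P : {fset nat}) (Es : seq {fset nat}).
Variable N : c00 R -> R.
Hypothesis Nimp : implicit_norm admissible (fun=> 2^-1) 2^-1 N.

Definition low (D : {fset nat}) a : {fset nat} := [fset i in D | (i < a)%N]%fset.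
Definition mid (D : {fset nat}) a d : {fset nat} :=
  [fset i in D | (a <= i < a + d)%N]%fset.
Definition high (D : {fset nat}) a : {fset nat} := [fset i in D | (a <= i)%N]%fset.

Definition three_parts D x a d : R :=
  N (restr (low D a) x) + N (restr (mid D a d) x) +
  N (restr (high D (a + d)) x).

(** Cutting points beyond [D] change nothing, so there are finitely many values
    to compare. Having a maximum that is attained lets the induction choose the
    cutting points of each block before summing over the blocks. *)
Lemma three_parts_max D x : exists a d, forall a' d',
  three_parts D x a' d' <= three_parts D x a d.
Proof.
pose n := (\max_(i <- D) i.+1)%N.
have Dn i : i \in D -> (i < n)%N.
  by move=> iD; rewrite /n (big_rem i)//= leq_max leqnn.
pose v (p : 'I_n.+1 * 'I_n.+1) := three_parts D x p.1 p.2.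
case: (@arg_maxP _ _ _ (ord0, ord0) xpredT v isT) => -[a d] _ adP.
exists a, d => a' d'.
have -> : three_parts D x a' d' = three_parts D x (minn a' n) (minn d' n).
  rewrite /three_parts; congr (N (restr _ x) + N (restr _ x) + N (restr _ x));
    apply/fsetP => i; rewrite !inE; case: (boolP (i \in D)) => //= /Dn; lia.
have an : (minn a' n < n.+1)%N by lia.
have dn : (minn d' n < n.+1)%N by lia.
exact: (adP (Ordinal an, Ordinal dn)).
Qed.

Lemma tsirelson_group_le P x Es : blocks Es ->
  (forall i, i \in head fset0 Es -> (size Es <= i.+1)%N) ->
  (forall E, E \in Es -> (E `<=` P)%fset) ->
  2^-1 * block_sum N x Es <= N (restr P x).
Proof.
move=> Esb Esh EsP; case: (posnP (size Es)) => [/size0nil->|Es0].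
  by rewrite /block_sum big_nil mulr0 (inorm_ge0 Nimp).
have := inorm_blocks Nimp (restr P x) (And3 Esb Es0 Esh).
apply: le_trans; rewrite ler_wpM2l ?invr_ge0// /block_sum !big_seq.
by apply: ler_sum => E EEs; rewrite restr_sub// EsP.
Qed.

Definition cut (Es : seq {fset nat}) : nat :=
  (\max_(E <- Es) \max_(i <- E) i.+1)%N.

Lemma ltn_cut Es E i : E \in Es -> i \in E -> (i < cut Es)%N.
Proof.
move=> EEs iE; rewrite /cut (big_rem E)//= (big_rem i iE)/=.
by rewrite !leq_max leqnn.
Qed.

Lemma cut_leq Es j : (forall E i, E \in Es -> i \in E -> (i < j)%N) ->
  (cut Es <= j)%N.
Proof.
move=> h; rewrite /cut big_seq; elim/big_ind: _ => // [m n|E EEs].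
  by rewrite geq_max => -> ->.
rewrite big_seq; elim/big_ind: _ => // [m n|i iE]; last exact: h iE.
by rewrite geq_max => -> ->.
Qed.

(** The admissibility condition asks for at most [p] sets beyond the index [p],
    counted from 1. With [p = m] the first set may open a group of [m] sets. The
    next group then starts at [2m] at least and may have [2m] sets. At most [3m]
    of the [6m] sets remain, and they lie beyond the [3m] sets already placed,
    hence beyond the index [3m]: they form the third group. *)
Lemma tsirelson_regroup D x Es : blocks Es ->
  (forall E, E \in Es -> (E `<=` D)%fset) ->
  (forall E i, E \in Es -> i \in E -> (size Es <= 6 * i.+1)%N) ->
  exists a d, 2^-1 * block_sum N x Es <= three_parts D x a d.
Proof.
move=> Esb EsD Es6.
(* [m] is the size divided by 6, rounded up; by hypothesis it is at most the
   1-based position of each element of each set. *)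
pose m := ((size Es + 5) %/ 6)%N.
have mE : (size Es <= 6 * m)%N by rewrite /m; lia.
have Em E i : E \in Es -> i \in E -> (m <= i.+1)%N.
  by move=> EEs iE; have := Es6 _ _ EEs iE; rewrite /m; lia.
pose s1 := take m Es; pose s2 := take m.*2 (drop m Es).
pose s3 := drop m.*2 (drop m Es).
have Es_cat : Es = s1 ++ (s2 ++ s3) by rewrite /s1 /s2 /s3 !cat_take_drop.
have := Esb; rewrite [in blocks _]Es_cat => /blocks_cat[b1 /blocks_cat[b2 b3 lt23] lt1].
have in1 E : E \in s1 -> E \in Es by rewrite Es_cat mem_cat => ->.
have in2 E : E \in s2 -> E \in Es by rewrite Es_cat !mem_cat => ->; rewrite orbT.
have in3 E : E \in s3 -> E \in Es by rewrite Es_cat !mem_cat => ->; rewrite !orbT.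
have hd (s : seq {fset nat}) : head fset0 s = nth fset0 s 0 by case: s.
have mem_hd (s : seq {fset nat}) i : i \in head fset0 s -> head fset0 s \in s.
  by case: s => //= E s _; rewrite mem_head.
have nth_ge k c i : (forall j, j \in head fset0 Es -> (c <= j)%N) ->
    i \in nth fset0 Es k -> (c + k <= i)%N.
  by move=> Ec; exact: (block_nth_ge Esb Ec).
pose a := cut s1; pose b := cut (s1 ++ s2).
have ab : (a <= b)%N.
  by apply: cut_leq => E i Es1; apply: ltn_cut; rewrite mem_cat Es1.
exists a, (b - a)%N.
have -> : block_sum N x Es =
    block_sum N x s1 + block_sum N x s2 + block_sum N x s3.
  by rewrite [in LHS]Es_cat /block_sum !big_cat/= addrA.
rewrite !mulrDr /three_parts.
have sub (P : nat -> bool) (s : seq {fset nat}) : (forall E, E \in s -> E \in Es) ->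
    (forall E i, E \in s -> i \in E -> P i) ->
    forall E, E \in s -> (E `<=` [fset i in D | P i])%fset.
  move=> sEs sP E Es'; apply/fsubsetP => i iE; rewrite !inE (sP E)// andbT.
  by apply: (fsubsetP (EsD E (sEs _ Es'))).
apply: lerD; first apply: lerD.
- apply: tsirelson_group_le => //.
    move=> i ih; apply: leq_trans (Em _ i (in1 _ (mem_hd _ _ ih)) ih).
    by rewrite size_take_min geq_minl.
  by apply: sub => // E i; exact: ltn_cut.
- apply: tsirelson_group_le => //.
    move=> i; rewrite hd => ih.
    have s2m : (size s2 <= m.*2)%N by rewrite size_take_min geq_minl.
    have [m0|m0] := posnP m; first by move: s2m; lia.
    move: ih; rewrite {1}/s2 nth_take ?double_gt0// nth_drop addn0 => ih.
    have h := nth_ge m m.-1 i _ ih.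
    suff : (m.-1 + m <= i)%N by lia.
    by apply: h => j jh; have := Em _ _ (mem_hd _ _ jh) jh; lia.
  apply: sub => // E i Es2 iE; rewrite subnKC//; apply/andP; split.
    apply: cut_leq => F j Fs1 jF.
    have /fset_ltP lFE : fset_lt F E by apply: lt1; rewrite // mem_cat Es2.
    exact: lFE jF iE.
  by apply: ltn_cut iE; rewrite mem_cat Es2 orbT.
- apply: tsirelson_group_le => //.
    move=> i; rewrite hd /s3 !nth_drop addn0 => ih.
    have : (0 + (m + m.*2) <= i)%N by apply: nth_ge ih.
    by rewrite !size_drop; lia.
  apply: sub => // E i Es3 iE; rewrite subnKC//.
  apply: cut_leq => F j; rewrite mem_cat => /orP[Fs1|Fs2] jF.
    have /fset_ltP lFE : fset_lt F E.
      by apply: lt1; rewrite // mem_cat Es3 orbT.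
    exact: lFE jF iE.
  have /fset_ltP lFE := lt23 F E Fs2 Es3.
  exact: lFE jF iE.
Qed.

(** The three pieces obtained for each block are concatenated; they are still
    successive since the pieces of a block stay inside it. *)
Lemma tsirelson_refine (b : bool) x Es : pairwise fset_lt Es ->
  (forall E, E \in Es -> exists a d, N (restr E (stretch b x)) <=
     three_parts (fset_shrink b E) x a d) ->
  exists Fs, [/\ pairwise fset_lt Fs, (size Fs <= 3 * size Es)%N,
    forall F, F \in Fs -> exists2 E, E \in Es & (F `<=` fset_shrink b E)%fset &
    block_sum N (stretch b x) Es <= block_sum N x Fs].
Proof.
elim: Es => [|E Es IH] /=.
  by move=> _ _; exists [::]; split=> //; rewrite /block_sum !big_nil.
move=> /andP[/allP EEs Es_lt] hE.
have [F FEs|Fs [Fs_lt Fs3 FsEs FsN]] := IH Es_lt.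
  by apply: hE; rewrite inE FEs orbT.
have [a [d adN]] := hE E (mem_head _ _).
pose P := fset_shrink b E.
have lowP : (low P a `<=` P)%fset by exact: fset_sub.
have midP : (mid P a d `<=` P)%fset by exact: fset_sub.
have highP : (high P (a + d) `<=` P)%fset by exact: fset_sub.
have PFs G F : F \in Fs -> (G `<=` P)%fset -> fset_lt G F.
  move=> FFs GP; have [E' E'Es FE'] := FsEs F FFs.
  by apply: fset_lt_sub GP FE' _; apply: fset_shrink_lt; exact: EEs.
exists [:: low P a, mid P a d, high P (a + d) & Fs]; split.
- rewrite /= Fs_lt andbT; do ![apply/andP; split] => //;
    try (by apply/allP => F FFs; exact: PFs);
    by apply/fset_ltP => i j; rewrite !inE => /andP[_ +] /andP[_ +]; lia.
- by rewrite /=; lia.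
- move=> F; rewrite !inE => /or4P[/eqP->|/eqP->|/eqP->|/FsEs[E' E'Es FE']];
    [by exists E => //; rewrite mem_head..|].
  by exists E' => //; rewrite inE E'Es orbT.
- rewrite /block_sum !big_cons !addrA; apply: lerD => //.
Qed.

(** The bound by three successive restrictions of [x] is stronger than
    [N (stretch b x) <= 3 * N x], and it is what makes the constant stable under
    the induction. An admissible family of [k] blocks satisfies [k <= 2p] for
    each 1-based index [p] occurring in its pull-back. By induction each block
    contributes three pieces, so there are at most [3k <= 6p] pieces, which
    regroup into three admissible families. *)
Lemma tsirelson_stretch_three_parts b D x : supported D x ->
  exists a d, N (stretch b x) <= three_parts D x a d.
Proof.
move: D x; apply: fset_proper_ind => D IH x Dx.
have [a [d ad_max]] := three_parts_max D x; exists a, d.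
have ge_part a' d' c : c <= three_parts D x a' d' -> c <= three_parts D x a d.
  by move/le_trans; apply; exact: ad_max.
have Nx : N x <= three_parts D x a d.
  apply: (ge_part 0%N 0%N); rewrite /three_parts.
  rewrite [restr (high _ _) x](restr_id Dx).
    by rewrite lerDr addr_ge0// (inorm_ge0 Nimp).
  by apply/fsubsetP => i iD; rewrite !inE iD.
apply: (inorm_least_proper Nimp (supported_stretch (b := b) Dx)).
  move=> k; apply: le_trans Nx; rewrite /stretch/=; case: ifP => _.
    exact: (inorm_coord Nimp).
  by rewrite normr0 (inorm_ge0 Nimp).
move=> Es Es_adm EsD; have [/andP[/allP Es0 Es_lt] Es1 Esh] := Es_adm.
have hE E : E \in Es -> exists a d, N (restr E (stretch b x)) <=
    three_parts (fset_shrink b E) x a d.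
  move=> EEs; pose P := fset_shrink b E.
  have := EsD E EEs; rewrite fset_stretch_sub => /IH.
  move=> /(_ _ (supported_restr Dx))[a' [d' ad']]; exists a', d'.
  rewrite restr_stretch; apply: (le_trans ad').
  have restrD (G G' : {fset nat}) (y : c00 R) : (forall i, i \in D -> (i \in G) = (i \in G')) ->
      supported D y -> restr G y = restr G' y.
    move=> GG Dy; apply: c00_ext => i; rewrite !restrE.
    by case: (boolP (i \in D)) => [/GG->//|/Dy->]; rewrite !if_same.
  rewrite /three_parts !restr_sub; try by
    apply/fsubsetP => i; rewrite !inE => /andP[/andP[]].
  rewrite le_eqVlt; apply/orP; left; apply/eqP; congr (N _ + N _ + N _); apply: restrD => // i iD;
    by rewrite !inE iD andbT.
have [Fs [Fs_lt Fs3 FsEs FsN]] := tsirelson_refine Es_lt hE.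
pose Hs := [seq (F `&` D)%fset | F <- Fs].
have Hs_lt : pairwise fset_lt Hs.
  rewrite pairwise_map; apply: sub_pairwise Fs_lt => F G.
  by apply: fset_lt_sub; exact: fsubsetIl.
have HsN : block_sum N x Hs = block_sum N x Fs.
  rewrite /block_sum big_map; apply: eq_bigr => F _.
  by rewrite -restr_restr (restr_id Dx).
have := @tsirelson_regroup D x _ (blocks_filter Hs_lt).
rewrite (block_sum_filter Nimp) HsN => -[||a' [d' ad']].
- by move=> H; rewrite mem_filter => /andP[_ /mapP[F _ ->]]; exact: fsubsetIr.
- move=> H i; rewrite mem_filter => /andP[_ /mapP[F FFs ->]].
  rewrite inE => /andP[iF _].
  apply: leq_trans (_ : (3 * size Es <= _)%N).
    apply: leq_trans Fs3; rewrite -(size_map (fun F => F `&` D)%fset Fs).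
    by rewrite size_filter count_size.
  have [E EEs /fsubsetP/(_ i iF)] := FsEs F FFs.
  rewrite mem_fset_shrink -(nth_index fset0 EEs) => iE.
  have [Esb _ _] := Es_adm.
  have : ((size Es).-1 + index E Es <= b + i.*2)%N.
    by apply: (block_nth_ge Esb _ iE) => j /Esh; case: (size Es).
  by move: (size Es) (index E Es) => k l; clear; case: b; lia.
apply: (ge_part a' d'); apply: le_trans ad'.
by rewrite ler_wpM2l// invr_ge0.
Qed.

Lemma tsirelson_stretch_le b x : N (stretch b x) <= 3 * N x.
Proof.
have [D Dx] := ex_support x.
have [a [d /le_trans]] := tsirelson_stretch_three_parts b Dx; apply.
rewrite /three_parts.
have := le_inorm_restr Nimp (low D a) x.
have := le_inorm_restr Nimp (mid D a d) x.
have := le_inorm_restr Nimp (high D (a + d)) x; lra.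
Qed.

End TsirelsonStretch.

(** * Extension of bounded operators by density *)

Section Extension.
Context {R : realType} (V : lmodType R) (T : normedModType R)
  (Y : completeNormedModType R).
Variables (iota : {linear V -> T}) (g : {linear V -> Y}) (C : R).
Hypothesis iota_dense : dense (range iota).
Hypothesis gC : forall v, `|g v| <= C * `|iota v|.

Lemma dense_approx y (e : R) : 0 < e -> exists v, `|y - iota v| < e.
Proof.
move=> e0; have [||z [yz [v _ vz]]] := iota_dense (O := ball y e).
- by exists y; exact: ballxx.
- exact: ball_open.
- by exists v; rewrite vz; move: yz; rewrite -ball_normE.
Qed.

(** The value at [y] is a point [l] with [|l - g v| <= C * |y - iota v|] for all
    [v]. Completeness provides it, as a limit along approximations of [y], and
    the inequality alone forces linearity and the bound. *)
Lemma bounded_extension : 0 <= C -> exists2 L : {linear T -> Y},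
  (forall v, L (iota v) = g v) & (forall y, `|L y| <= C * `|y|).
Proof.
move=> C0.
have /choice[L LP] : forall y, exists l, forall v,
    `|l - g v| <= C * `|y - iota v|.
  move=> y.
  have /choice[a ay] : forall n, exists v, `|y - iota v| < n.+1%:R^-1.
    by move=> n; apply: dense_approx; rewrite invr_gt0.
  have ga n m : `|g (a n) - g (a m)| <= C * (n.+1%:R^-1 + m.+1%:R^-1).
    rewrite -linearB (le_trans (gC _))// ler_wpM2l// linearB/=.
    rewrite -[iota (a n)](subrK y) -addrA (le_trans (ler_normD _ _))//.
    by rewrite lerD// ltW// distrC.
  have gcvg : cvgn (g \o a).
    apply/cauchy_cvgP/cauchy_exP => e e0.
    have e0' : 0 < e / (2 * C + 1) by rewrite divr_gt0// ltr_wpDl ?mulr_ge0.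
    have [M _ Me] := near_infty_natSinv_lt (PosNum e0').
    exists (g (a M)); exists M => // n /= Mn; rewrite -ball_normE/=.
    apply: le_lt_trans (ga _ _) _.
    have h1 := Me M (leqnn M); have h2 := Me n Mn; rewrite /= in h1 h2.
    move: h1 h2; rewrite !ltr_pdivlMr ?ltr_wpDl ?mulr_ge0// => h1 h2.
    have p1 : 0 < M.+1%:R^-1 :> R by rewrite invr_gt0.
    have p2 : 0 < n.+1%:R^-1 :> R by rewrite invr_gt0.
    move: h1 h2 p1 p2; move: M.+1%:R^-1 n.+1%:R^-1 => q1 q2; lra.
  exists (limn (g \o a)) => v.
  have l1 : `|(g \o a) n - g v| @[n --> \oo] --> `|limn (g \o a) - g v|.
    by apply: cvg_norm; apply: cvgB => //; exact: cvg_cst.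
  have ia : iota (a n) @[n --> \oo] --> y.
    apply/cvgrPdist_lt => e e0.
    have [M _ Me] := near_infty_natSinv_lt (PosNum e0).
    by exists M => // n /= /Me; apply: lt_trans.
  have l2 : C * `|iota (a n) - iota v| @[n --> \oo] --> C * `|y - iota v|.
    apply: cvgMl_tmp; apply: cvg_norm; apply: cvgB => //; exact: cvg_cst.
  apply: (ler_cvg_to l1 l2); apply: nearW => n /=.
  by rewrite -!linearB; exact: gC.
have Llin : linear L.
  move=> k y z; apply/eqP; rewrite -subr_eq0 -normr_le0.
  apply/ler_addgt0Pl => e e0; rewrite addr0.
  pose K := 2 * C * (`|k| + 1) + 1.
  have K0 : 0 < K by rewrite ltr_wpDl// !mulr_ge0// addr_ge0.
  have d0 : 0 < e / K by rewrite divr_gt0.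
  have [v yv] := dense_approx y d0; have [w zw] := dense_approx z d0.
  have E : L (k *: y + z) - (k *: L y + L z) =
      (L (k *: y + z) - g (k *: v + w)) - (k *: (L y - g v) + (L z - g w)).
    rewrite [g _]linearP scalerBr; move: (L (k *: y + z)) => a.
    move: (k *: L y) (k *: g v) (L z) (g w) => b p c q.
    rewrite [b - p + _]addrACA -(opprD p) [in RHS]opprB.
    by rewrite [RHS]addrA subrK.
  have h1 := LP (k *: y + z) (k *: v + w).
  have h2 : `|k *: y + z - iota (k *: v + w)| <= `|k| * (e / K) + e / K.
    rewrite linearP/= opprD addrACA -scalerBr (le_trans (ler_normD _ _))//.
    by rewrite normrZ lerD ?ler_wpM2l// ltW.
  have h3 : `|k *: (L y - g v) + (L z - g w)| <= C * (`|k| * (e / K) + e / K).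
    rewrite (le_trans (ler_normD _ _))// normrZ mulrDr lerD//.
      rewrite mulrCA ler_wpM2l// (le_trans (LP _ _))// ler_wpM2l//.
      exact: ltW.
    by rewrite (le_trans (LP _ _))// ler_wpM2l// ltW.
  have -> : e = K * (e / K) by rewrite mulrC divfK// gt_eqF.
  rewrite E (le_trans (ler_normB _ _))//.
  have := ler_wpM2l C0 h2; move: h1 h3; rewrite /K.
  have := ltW d0; move: (e / K) => t t0.
  have : 0 <= t * 1 by rewrite mulr1.
  lra.
pose L' : {linear T -> Y} :=
  HB.pack L (GRing.isLinear.Build R T Y *:%R _ Llin).
exists L' => [v|y].
  apply/eqP; rewrite -subr_eq0 -normr_le0.
  by have := LP (iota v) v; rewrite subrr normr0 mulr0.
by have := LP y 0; rewrite (linear0 g) (linear0 iota) !subr0.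
Qed.

End Extension.

(** * The dual space *)

Section DualSpace.
Context {R : realType} (V : normedModType R).
Implicit Types f : dual V.

Lemma bounded_is_dual (f : V -> R^o) (C : R) : linear f ->
  (forall x, `|f x| <= C * `|x|) -> f \in @is_dual R V.
Proof.
move=> flin fC; apply/asboolP; split=> // x; apply/cvgrPdist_lt => e e0.
pose C' := `|C| + 1.
have C'0 : 0 < C' by rewrite ltr_wpDl.
have d0 : 0 < e / C' by rewrite divr_gt0.
near=> y.
have xy : `|x - y| < e / C' by near: y; exact: cvgr_dist_lt.
have -> : f x - f y = f (x - y).
  by rewrite addrC -scaleN1r -flin scaleN1r addrC.
rewrite (le_lt_trans (fC _))//.
apply: (@le_lt_trans _ _ (C' * `|x - y|)).
  by rewrite ler_wpM2r// (le_trans (ler_norm _))// lerDl.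
by rewrite mulrC -ltr_pdivlMr.
Unshelve. all: by end_near.
Qed.

Lemma le_dual_norm f x : `|f x| <= `|f| * `|x|.
Proof.
have [->|x0] := eqVneq x 0; first by rewrite linear0 !normr0 mulr0.
have nx : 0 < `|x| by rewrite normr_gt0.
have : `|f (`|x|^-1 *: x)| <= `|f|.
  apply: dual_norm_ub.
  by rewrite normrZ normfV normr_id mulVf// gt_eqF.
rewrite linearZ/= normrM normfV normr_id mulrC.
by rewrite ler_pdivrMr.
Qed.

Lemma dual_norm_leP f c :
  (forall x, `|x| <= 1 -> `|f x| <= c) -> `|f| <= c.
Proof. exact: dual_norm_le. Qed.

Lemma dual_series (u : nat -> dual V) n x :
  series u n x = series (fun k => u k x : R^o) n.
Proof.
rewrite /series/=; elim: n => [|n IH]; first by rewrite !big_geq.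
by rewrite !big_nat_recr//= -IH.
Qed.

(** The pointwise sum of the series is a functional [l] whose distance to the
    partial sums is at most the tail of the series of norms. *)
Lemma dual_abs_series_cvg : abs_series_cvg (dual V).
Proof.
move=> u ucvg.
pose S := limn [normed series u].
have Sge n : [normed series u] n <= S.
  apply: nondecreasing_cvgn_le => //.
  by apply: nondecreasing_series => i _ _; exact: normr_ge0.
have ux_cvg x : cvgn (series (fun k => u k x : R^o)).
  apply: normed_cvg.
  apply: (@series_le_cvg _ _ (fun k => `|u k| * `|x|)) => [k|k|k|].
  - exact: normr_ge0.
  - by rewrite mulr_ge0.
  - exact: le_dual_norm.
  - have -> : series (fun k => `|u k| * `|x|) =
        (fun n => [normed series u] n * `|x|).
      by apply/funext => n; rewrite /series/= mulr_suml.
    by apply/cvg_ex; exists (S * `|x|); apply: cvgMr_tmp; exact: ucvg.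
pose l x : R^o := limn (series (fun k => u k x : R^o)).
have lB n x : `|l x - series u n x| <= (S - [normed series u] n) * `|x|.
  have h : `|series (fun k => u k x : R^o) m - series u n x| @[m --> \oo]
      --> `|l x - series u n x|.
    by apply: cvg_norm; apply: cvgB; [exact: ux_cvg|exact: cvg_cst].
  apply: (cvgr_to_le h); near=> m.
  have nm : (n <= m)%N by near: m; exact: nbhs_infty_ge.
  rewrite dual_series sub_series_geq// (le_trans (ler_norm_sum _ _ _))//.
  apply: (@le_trans _ _ (([normed series u] m - [normed series u] n) * `|x|)).
    rewrite sub_series_geq// mulr_suml; apply: ler_sum => k _.
    exact: le_dual_norm.
  by rewrite ler_wpM2r// lerD2r Sge.
have llin : linear l.
  move=> k x y; rewrite /l.
  have -> : series (fun i => u i (k *: x + y) : R^o) =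
      (fun n => k *: series (fun i => u i x : R^o) n +
                series (fun i => u i y : R^o) n).
    by apply/funext => n; rewrite -!dual_series linearP.
  apply: cvg_lim => //; apply: cvgD; last exact: ux_cvg.
  by apply: cvgZl_tmp; exact: ux_cvg.
have lbd x : `|l x| <= S * `|x|.
  have := lB 0%N x.
  by rewrite dual_series /series/= [X in S - X]big_geq// big_geq// !subr0.
pose F : dual V := Dual (bounded_is_dual llin lbd).
apply/cvg_ex; exists F; apply/cvgrPdist_le => e e0.
have /cvgrPdist_le/(_ e e0) uS : [normed series u] n @[n --> \oo] --> S.
  exact: ucvg.
near=> n.
apply: dual_norm_leP => x x1.
apply: (@le_trans _ _ ((S - [normed series u] n) * `|x|)).
  exact: lB.
apply: (@le_trans _ _ (S - [normed series u] n)).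
  by rewrite ler_piMr// subr_ge0 Sge.
rewrite (le_trans (ler_norm _))//.
by near: n; exact: uS.
Unshelve. all: by end_near.
Qed.

Lemma transpose_exists (L : {linear V -> V}) (C : R) :
  0 <= C -> (forall y, `|L y| <= C * `|y|) ->
  exists2 Lt : {linear dual V -> dual V},
    (forall f x, Lt f x = f (L x)) & (forall f, `|Lt f| <= C * `|f|).
Proof.
move=> C0 LC.
have fL f x : `|f (L x)| <= (`|f| * C) * `|x|.
  by rewrite (le_trans (le_dual_norm _ _))// -mulrA ler_wpM2l.
have fLlin f : linear (fun x => f (L x) : R^o).
  by move=> k x y; rewrite !linearP.
pose Lt f : dual V := Dual (bounded_is_dual (fLlin f) (fL f)).
have Ltlin : linear Lt by move=> k f h; apply/val_inj/funext.
pose Lt' : {linear dual V -> dual V} :=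
  HB.pack Lt (GRing.isLinear.Build R (dual V) (dual V) *:%R _ Ltlin).
exists Lt' => // f; apply: dual_norm_leP => x x1.
by rewrite (le_trans (fL f x))// [C * _]mulrC ler_piMr// mulr_ge0.
Qed.

Lemma dual_absorbs_square : absorbs_square V -> absorbs_square (dual V).
Proof.
move=> [A [B [C [C1 bd BA]]]]; have C0 : 0 <= C by rewrite (le_trans _ C1).
have /choice[At AtP] : forall b, exists Lt : {linear dual V -> dual V},
    (forall f x, Lt f x = f (A b x)) /\ (forall f, `|Lt f| <= C * `|f|).
  move=> b; have [//||Lt] := @transpose_exists (A b) C; last by exists Lt.
  by move=> y; case: (bd b y).
have /choice[Bt BtP] : forall b, exists Lt : {linear dual V -> dual V},
    (forall f x, Lt f x = f (B b x)) /\ (forall f, `|Lt f| <= C * `|f|).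
  move=> b; have [//||Lt] := @transpose_exists (B b) C; last by exists Lt.
  by move=> y; case: (bd b y).
exists Bt, At, C; split=> // [b f|b c f].
  by split; [have [_] := BtP b|have [_] := AtP b]; exact.
apply/val_inj/funext => x /=.
have [Ab _] := AtP b; have [Bc _] := BtP c.
rewrite Ab Bc BA eq_sym; case: eqP => // _; exact: linear0.
Qed.

End DualSpace.

(** * Two complemented copies in the completion *)

Section Completion.
Context {R : realType}.

(** The relations between [shrink] and [stretch] hold on a dense subspace and
    persist for the extensions. *)
Lemma completion_absorbs_square (N : c00 R -> R) (C : R)
    (T : completeNormedModType R) :
  1 <= C -> (forall b x, N (shrink b x) <= C * N x) ->
  (forall b x, N (stretch b x) <= C * N x) ->
  is_completion N T -> absorbs_square T.
Proof.
move=> C1 shrinkC stretchC [iota [iotaN iota_dense]].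
have C0 : 0 <= C by rewrite (le_trans _ C1).
have ext (M : c00 R -> c00 R) : linear M -> (forall x, N (M x) <= C * N x) ->
    exists L : {linear T -> T}, (forall v, L (iota v) = iota (M v)) /\
      (forall y, `|L y| <= C * `|y|).
  move=> Mlin MC.
  have glin : linear (fun v => iota (M v)).
    by move=> k x y; rewrite Mlin linearP.
  pose g : {linear c00 R -> T} := HB.pack (fun v => iota (M v))
    (GRing.isLinear.Build R (c00 R) T *:%R _ glin).
  have gC v : `|g v| <= C * `|iota v| by rewrite !iotaN.
  by have [L L1 L2] := bounded_extension iota_dense gC C0; exists L.
have /choice[A AP] := fun b => ext _ (@stretch_linear R b) (stretchC b).
have /choice[B BP] := fun b => ext _ (@shrink_linear R b) (shrinkC b).
exists A, B, C; split=> // [b y|b c y].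
  by split; [have [_] := AP b|have [_] := BP b]; exact.
apply/eqP; rewrite -subr_eq0 -normr_le0; apply/ler_addgt0Pl => e e0.
rewrite addr0; pose K := C * C + 1.
have K0 : 0 < K by rewrite ltr_wpDl// mulr_ge0.
have d0 : 0 < e / K by rewrite divr_gt0.
have [v yv] := dense_approx iota_dense y d0.
have [Ac AcC] := AP c; have [Bb BbC] := BP b.
pose z := y - iota v.
have -> : B b (A c y) - (if b == c then y else 0) =
    B b (A c z) - (if b == c then z else 0).
  rewrite /z (linearB (A c)) (linearB (B b)) Ac Bb shrink_stretch.
  case: eqP => _; last by rewrite (linear0 iota) !subr0.
  by rewrite opprB addrA subrK.
have -> : e = C * (C * (e / K)) + e / K.
  by rewrite mulrA -{2}[e / K]mul1r -mulrDl mulrC divfK// gt_eqF.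
rewrite (le_trans (ler_normB _ _))// lerD//.
  rewrite (le_trans (BbC _))// ler_wpM2l// (le_trans (AcC _))// ler_wpM2l//.
  exact: ltW.
by case: eqP => _; rewrite ?normr0 ltW.
Qed.

End Completion.

(** * The embedding theorem *)

Theorem corollary3p2 (R : realType) (X : completeNormedModType R) :
  (forall T : completeNormedModType R, is_tsirelson_space T ->
     (exists f : X -> dual T, uniform_embedding f) ->
     exists g : X -> dual T, strong_embedding g) /\
  (forall S : completeNormedModType R, is_schlumprecht_space S ->
     (exists f : X -> S, uniform_embedding f) ->
     exists g : X -> S, strong_embedding g).
Proof.
split=> [T [N [NT TN]]|S [N [NS SN]]].
  apply: strong_of_uniform; first exact: dual_abs_series_cvg.
  apply: dual_absorbs_square.
  have Nimp := tsirelson_implicit NT.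
  have Nsh := le_inorm_shrink Nimp admissible_stretch.
  apply: (@completion_absorbs_square _ N 3) TN => [|b x|b x]; first lra.
    rewrite (le_trans (Nsh b x))// ler_peMl ?(inorm_ge0 Nimp)//; lra.
  exact: tsirelson_stretch_le.
apply: strong_of_uniform; first by move=> u; exact: normed_cvg.
have Nimp := schlumprecht_implicit NS.
apply: (@completion_absorbs_square _ N 1) SN => // b x; rewrite mul1r.
  exact: (le_inorm_shrink Nimp schlumprecht_adm_stretch).
exact: schlumprecht_stretch_le.
Qed.
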